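(* Let $n\in\{1,2,3\}$. Then every real root $\gamma\in\Gamma_0(n)\cap\mathbb{R}$ satisfies $\gamma\ge-1$. That is, for every $0$-symmetric $n$-dimensional lattice polytope $P\subset\mathbb{R}^n$, every real zero of its Ehrhart polynomial $\mathrm{G}(s,P)$ is at least $-1$.
   Context: A lattice $n$-polytope is a convex polytope $P\subset\mathbb{R}^n$ with $\dim P=n$ all of whose vertices lie in $\mathbb{Z}^n$; it is $0$-symmetric if $P=-P$. The Ehrhart polynomial of $P$ is the unique polynomial $\mathrm{G}(s,P)$ in $s\in\mathbb{C}$ with $\mathrm{G}(k,P)=\#(kP\cap\mathbb{Z}^n)$ for all positive integers $k$. $\Gamma_0(n)\subset\mathbb{C}$ is the set of all zeros of Ehrhart polynomials $\mathrm{G}(s,P)$, where $P$ ranges over all $0$-symmetric lattice $n$-polytopes. *)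

(* Defs.v *)
From HB Require Import structures.
From mathcomp Require Export all_boot all_order all_algebra.
From mathcomp Require Export boolp classical_sets cardinality reals convex.
From mathcomp Require Export complex.

Set Implicit Arguments.
Unset Strict Implicit.
Unset Printing Implicit Defensive.

Import Order.TTheory GRing.Theory Num.Theory.

Local Open Scope classical_set_scope.
Local Open Scope card_scope.
Local Open Scope ring_scope.

Section Polytopes.
Variables (R : realType) (n : nat).
Implicit Types (A P : set 'rV[R]_n) (v : 'rV[R]_n) (k d : nat).

Definition convex_hull A : set 'rV[R]_n :=
  smallest (@convex_set R 'rV[R]_n) A.

Definition polytope P : Prop :=
  exists s : seq 'rV[R]_n, P = convex_hull [set` s].

(* The vertices of a polytope are its extreme points. *)
Definition vertex P v : Prop :=
  P v /\ forall x y (t : R), P x -> P y -> 0 < t < 1 ->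
    v = t *: x + (1 - t) *: y -> x = v /\ y = v.

Definition affine_set A : Prop :=
  forall x y (t : R), A x -> A y -> A (t *: x + (1 - t) *: y).

Definition affine_hull A : set 'rV[R]_n := smallest affine_set A.

Definition has_dim A d : Prop :=
  exists p : 'rV[R]_n, exists2 U : {vspace 'rV[R]_n},
    \dim U = d & affine_hull A = [set p + u | u in [set` U]].

Definition integer_lattice : set 'rV[R]_n :=
  [set x | forall j, x 0 j \is a Num.int].

Definition lattice_polytope P : Prop :=
  [/\ polytope P, has_dim P n & vertex P `<=` integer_lattice].

Definition zero_symmetric P : Prop := P = [set - x | x in P].

Definition dilate k P : set 'rV[R]_n := [set k%:R *: x | x in P].

(* At most one G satisfies this, since it prescribes the values of G at
   infinitely many points. *)
Definition ehrhart_polynomial P (G : {poly R[i]}) : Prop :=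
  forall k, (0 < k)%N ->
    exists2 m : nat, dilate k P `&` integer_lattice #= `I_m
                   & G.[k%:R] = m%:R.

End Polytopes.

Definition Gamma0 (R : realType) (n : nat) : set R[i] :=
  [set s | exists P : set 'rV[R]_n,
     [/\ lattice_polytope P, zero_symmetric P &
         exists2 G : {poly R[i]}, ehrhart_polynomial P G & root G s]].

Arguments Gamma0 : clear implicits.

(* Main.v *)
Require Import Defs.
From mathcomp Require Import perm interval_inference polyrcf.
From mathcomp Require Import zify ring lra.

(* Write P as the convex hull of finitely many lattice points, the rows of a
   matrix V, which positively span the space because P = -P is full
   dimensional. Minimising a generic perturbation of the sum of the coefficients
   among the conic representations of a point singles out simplicial cones
   spanned by rows of V on which the gauge of P is linear; moving each point
   slightly in a fixed generic direction q makes the cones half-open and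
   disjoint. Counting lattice points in each half-open cone modulo a common
   denominator gives G(k) as a sum of binomials C(k + n - c, n), and
   (-1)^n G(-k) counts the lattice points of gauge < k in the cones that are
   half-open for -q. These contain every lattice point of (k-1)P, so that
   G(0) >= 0, (-1)^n G(-1) >= 0 and G(k-1) <= (-1)^n G(-k). For n = 3 the growth
   of the last inequality gives 3 a_3 >= 2 a_2, and writing
     -G(-t) = t (t-1) (a_3 (t+1) - a_2) + t (-G(-1)) + (t-1) G(0)
   excludes roots -t with t > 1; n = 1 and n = 2 are similar. *)

Set Implicit Arguments.
Unset Strict Implicit.
Unset Printing Implicit Defensive.

Import Order.TTheory GRing.Theory Num.Theory.

Local Open Scope complex_scope.
Local Open Scope ring_scope.

(** * Bases selected by linear programming *)

Section LinearProgramming.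
Variables (R : realFieldType) (m n : nat) (V : 'M[R]_(m, n)).
Implicit Types (y : 'rV[R]_n) (w : 'cV[R]_m).

(** The ratio test of the simplex method: take [i] minimising [c i / z i] among the entries with
    [z i > 0]. Moving from [c] along [- z] by that step, entry [i] reaches zero and no entry becomes
    negative. *)
Lemma ratio_test (I : finType) (c z : I -> R) i0 :
    (forall i, 0 <= c i) -> 0 < z i0 ->
  exists2 i, 0 < z i & forall j, 0 <= c j - c i / z i * z j.
Proof.
move=> c_ge0 zi0.
case: (@Order.TotalTheory.arg_minP _ _ _ i0 (fun i => 0 < z i) (fun i => c i / z i) zi0).
move=> i zi imin; exists i => // j; rewrite subr_ge0.
have t_ge0 : 0 <= c i / z i by rewrite divr_ge0 // ltW.
case: (ltrP 0 (z j)) => zj; first by rewrite -ler_pdivlMr // imin.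
by rewrite (le_trans _ (c_ge0 j)) // mulr_ge0_le0.
Qed.

(** More than [n] rows are linearly dependent; moving the coefficients along a dependency until one
    of them vanishes removes a row. Repetitions are allowed, so exactly [n] rows remain. *)
Lemma conic_caratheodory d K (f : 'I_K -> 'I_m) (c : 'rV[R]_K) :
    K = (n + d)%N -> (forall i, 0 <= c 0 i) ->
  exists (g : {ffun 'I_n -> 'I_m}) (e : 'rV_n),
    (forall i, 0 <= e 0 i) /\ c *m rowsub f V = e *m rowsub g V.
Proof.
elim: d K f c => [|d IH] K f c; first rewrite addn0.
  move=> eKn; subst K => c_ge0; exists [ffun i => f i], c; split=> //.
  by congr (_ *m _); apply/matrixP => i j; rewrite !mxE ffunE.
rewrite addnS => eK; subst K => c_ge0.
set M := rowsub f V.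
have [z [zM [i0 zi0]]] : exists z : 'rV_(n + d).+1,
    z *m M = 0 /\ exists i, 0 < z 0 i.
  have /rowV0Pn[z /sub_kermxP zM /rV0Pn[i zi]] : kermx M != 0.
    by rewrite kermx_eq0 /row_free neq_ltn (leq_ltn_trans (rank_leq_col M)) //
      ltnS leq_addr.
  case: (ltrgtP 0 (z 0 i)) zi => // zi _; first by exists z; split => //; exists i.
  exists (- z); rewrite mulNmx zM oppr0; split => //; exists i.
  by rewrite mxE oppr_gt0.
have [i zi c'_ge0] := ratio_test c_ge0 zi0.
set t := c 0 i / z 0 i in c'_ge0.
have [g [e [e_ge0 ce]]] := IH _ (f \o lift i)
  (\row_j (c 0 (lift i j) - t * z 0 (lift i j))) erefl
  (fun j => eq_ind_r (fun x => 0 <= x) (c'_ge0 (lift i j)) (mxE _ _ _ _)).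
exists g, e; split=> //; rewrite -ce.
have -> : c *m M = (c - t *: z) *m M by rewrite mulmxBl -scalemxAl zM scaler0 subr0.
rewrite !mulmx_sum_row (bigD1_ord i) //= !mxE.
rewrite {1}/t divfK ?gt_eqF // subrr scale0r add0r.
apply: eq_bigr => j _; rewrite !mxE; congr (_ *: _).
by apply/rowP => k; rewrite !mxE.
Qed.

Definition generic y := forall f : {ffun 'I_n -> 'I_m},
  ((y <= rowsub f V)%MS -> rowsub f V \in unitmx) /\
  (rowsub f V \in unitmx -> forall i, (y *m invmx (rowsub f V)) 0 i != 0).

(* A basis of rows is dual feasible when the linear functional taking the
   values [w] on it stays strictly below [w] on the other rows. *)
Definition dual_feasible w (f : {ffun 'I_n -> 'I_m}) :=
  rowsub f V \in unitmx /\ forall j, j \notin codom f ->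
    (row j V *m invmx (rowsub f V) *m rowsub f w) 0 0 < w j 0.

Lemma generic_basis_pos y (f : {ffun 'I_n -> 'I_m}) (e : 'rV_n) :
    generic y -> (forall i, 0 <= e 0 i) -> y = e *m rowsub f V ->
  rowsub f V \in unitmx /\ forall i, 0 < (y *m invmx (rowsub f V)) 0 i.
Proof.
move=> gy e_ge0 ye; have [unitM nz] := gy f.
have uM : rowsub f V \in unitmx by apply: unitM; rewrite ye submxMl.
split=> // i; rewrite lt_def nz //=.
by rewrite ye mulmxK.
Qed.

Lemma row_codom_ffun (f : {ffun 'I_n -> 'I_m}) j : j \in codom f ->
  exists2 i, j = f i & row j V = row i (rowsub f V).
Proof. by case/codomP => i ->; exists i => //; apply/rowP=> k; rewrite !mxE. Qed.

(** A primal feasible basis of least cost is dual feasible, since otherwise a pivot would lower the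
    cost. The second hypothesis excludes ties, which makes the inequalities strict. *)
Lemma dual_feasible_exists w y (c : 'rV[R]_m) :
    (forall j, 0 < w j 0) ->
    (forall f : {ffun 'I_n -> 'I_m}, rowsub f V \in unitmx ->
      forall j, j \notin codom f ->
      (row j V *m invmx (rowsub f V) *m rowsub f w) 0 0 != w j 0) ->
    generic y -> (0 < m)%N -> (forall j, 0 <= c 0 j) -> y = c *m V ->
  exists2 f : {ffun 'I_n -> 'I_m}, dual_feasible w f &
    forall i, 0 < (y *m invmx (rowsub f V)) 0 i.
Proof.
move=> w_gt0 gw gy m_gt0 c_ge0 yc.
pose feas (f : {ffun 'I_n -> 'I_m}) := (rowsub f V \in unitmx) &&
  [forall i, 0 < (y *m invmx (rowsub f V)) 0 i].
pose cost (f : {ffun 'I_n -> 'I_m}) :=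
  (y *m invmx (rowsub f V) *m rowsub f w) 0 0.
have [f0 feas0] : exists f, feas f.
  pose j0 := Ordinal m_gt0.
  pose h (i : 'I_(n + m)) := match split i with inl _ => j0 | inr j => j end.
  (* Prepending [n] copies of row [j0] with coefficient zero brings the number of generators to the
     required form [n + m]. *)
  have := @conic_caratheodory m _ h (row_mx 0 c) erefl.
  case=> [i|g [e [e_ge0 ce]]].
    by case: (splitP i) => j ij; rewrite mxE;
       case: splitP => k; rewrite ?ij ?mxE //.
  exists g; apply/andP.
  have [] := @generic_basis_pos y g e gy e_ge0; last by move=> ? ?; split; last apply/forallP.
  rewrite -ce yc [RHS]mulmx_sum_row big_split_ord /= big1 ?add0r.
    rewrite mulmx_sum_row; apply: eq_bigr => j _.
    rewrite row_mxEr; congr (_ *: _); apply/rowP => k; rewrite !mxE /h.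
    by rewrite -/(unsplit (inr j)) unsplitK.
  by move=> j _; rewrite row_mxEl mxE scale0r.
case: (@Order.TotalTheory.arg_minP _ _ _ f0 feas cost feas0) =>
  f /andP[uM /forallP yf_gt0] fmin.
exists f => //; split=> // j jf; rewrite lt_def eq_sym gw //= leNgt; apply/negP => wj.
set M := rowsub f V in uM yf_gt0 wj *.
pose dd := row j V *m invmx M; rewrite -/dd in wj.
(* If row [j] had no positive coordinate, its cost in the basis would be at most 0, against [wj] and
   the positivity of [w]. *)
have [i0 di0] : exists i, 0 < dd 0 i.
  apply/existsP; rewrite -[X in is_true X]negbK negb_exists; apply/negP => /forallP d_le0.
  have : (dd *m rowsub f w) 0 0 <= 0.
    rewrite mxE sumr_le0 // => i _; rewrite [rowsub _ _ _ _]mxE.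
    by apply: mulr_le0_ge0 (ltW (w_gt0 _)); rewrite leNgt; exact: d_le0.
  by rewrite leNgt (lt_trans (w_gt0 j)).
pose yc' := y *m invmx M.
have [i di c'_ge0] := @ratio_test _ (fun i => yc' 0 i) (fun i => dd 0 i) i0
  (fun i => ltW (yf_gt0 i)) di0.
set t := yc' 0 i / dd 0 i in c'_ge0.
have t_gt0 : 0 < t by rewrite divr_gt0 // /yc' yf_gt0.
pose f' : {ffun 'I_n -> 'I_m} := [ffun k => if k == i then j else f k].
pose e : 'rV_n := \row_k (if k == i then t else yc' 0 k - t * dd 0 k).
have e_ge0 k : 0 <= e 0 k by rewrite mxE; case: eqP => // _; exact: ltW.
(* Stated for every [A] because it serves twice: with [V] it shows that the pivot still represents
   [y], with [w] it gives the change of cost. *)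
have eE (p : nat) (A : 'M_(m, p)) :
    e *m rowsub f' A = yc' *m rowsub f A - t *: (dd *m rowsub f A) + t *: row j A.
  rewrite !mulmx_sum_row scaler_sumr -sumrB (bigD1 i) //= addrC [in RHS](bigD1 i) //=.
  have -> : yc' 0 i *: row i (rowsub f A) - t *: (dd 0 i *: row i (rowsub f A)) = 0.
    by rewrite scalerA /t divfK ?subrr // gt_eqF.
  rewrite add0r; congr (_ + _).
    apply: eq_bigr => k /negPf ki; rewrite !mxE ki scalerA -scalerBl; congr (_ *: _).
    by apply/rowP => l; rewrite !mxE ffunE ki.
  rewrite !mxE eqxx; congr (_ *: _); apply/rowP => l; rewrite !mxE ffunE eqxx //.
have ye : y = e *m rowsub f' V.
  by rewrite eE /yc' /dd !mulmxKV // subrK.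
have [uM' y_pos] := generic_basis_pos gy e_ge0 ye.
have /fmin : feas f' by rewrite /feas uM'; apply/forallP.
rewrite leNgt /cost {1}ye mulmxK // eE -/M -/yc' /=.
rewrite !mxE -addrA gtrDl addrC subr_lt0 ltr_pM2l //.
move: wj; rewrite mxE => wj.
by rewrite wj.
Qed.

(** Weak duality with its equality case: expanding [y] with positive coefficients in the basis [g]
    bounds the cost of [f] by that of [g], with equality exactly when every row of [g] belongs to
    [f]. Exchanging the roles forces equality. *)
Lemma dual_feasible_codom w y (f g : {ffun 'I_n -> 'I_m}) :
    dual_feasible w f -> dual_feasible w g ->
    (forall i, 0 < (y *m invmx (rowsub f V)) 0 i) ->
    (forall i, 0 < (y *m invmx (rowsub g V)) 0 i) ->
  codom f =i codom g.
Proof.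
pose cost (f : {ffun 'I_n -> 'I_m}) :=
  (y *m invmx (rowsub f V) *m rowsub f w) 0 0.
have step f1 g1 : dual_feasible w f1 -> dual_feasible w g1 ->
    (forall i, 0 < (y *m invmx (rowsub g1 V)) 0 i) ->
    cost f1 <= cost g1 ?= iff [forall i, g1 i \in codom f1].
  move=> [uf df] [ug dg] yg.
  have -> : cost f1 = \sum_i (y *m invmx (rowsub g1 V)) 0 i *
     (row (g1 i) V *m invmx (rowsub f1 V) *m rowsub f1 w) 0 0.
    have -> : cost f1 = (y *m invmx (rowsub g1 V) *m
        (rowsub g1 V *m (invmx (rowsub f1 V) *m rowsub f1 w))) 0 0.
      by rewrite /cost !mulmxA mulmxKV.
    rewrite mxE; apply: eq_bigr => i _.
    by congr (_ * _); rewrite -row_rowsub -mulmxA -row_mul [RHS]mxE.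
  rewrite /cost [X in _ <= X ?= iff _]mxE.
  apply: leif_sum => i _; rewrite [rowsub g1 w _ _]mxE.
  apply/leifP; case: ifPn => gi.
    apply/eqP; congr (_ * _); have [k gk ->] := row_codom_ffun gi.
    by rewrite -row_mul mulmxV // -row_mul mul1mx !mxE gk.
  by rewrite ltr_pM2l //; exact: df.
move=> df dg yf yg.
have fg := step f g df dg yg; have gf := step g f dg df yf.
have e : cost f = cost g by apply/eqP; rewrite eq_le fg gf.
have : [forall i, g i \in codom f] by rewrite -(ge_leif fg) e.
have : [forall i, f i \in codom g] by rewrite -(ge_leif gf) e.
move=> /forallP h1 /forallP h2 j; apply/idP/idP.
  by case/codomP=> i ->.
by case/codomP=> i ->.
Qed.

End LinearProgramming.

(** * Generic perturbations *)

(** Either ['X] divides [p] and the quotient is handled by induction, or the constant term dominates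
    near 0. The product form of the sign condition says nothing when [p.[0]] vanishes. *)
Lemma poly_sign_near0 (R : realFieldType) (p : {poly R}) : p != 0 ->
  exists2 d, 0 < d & forall s, 0 < s < d -> p.[s] != 0 /\ 0 <= p.[0] * p.[s].
Proof.
elim/poly_ind: p => [/eqP//|p c IH].
have [-> | c_neq0] := eqVneq c 0.
  rewrite addr0 => pX; have {IH} [|d d_gt0 dP] := IH.
    by apply: contraNneq pX => ->; rewrite mul0r.
  exists d => // s sd; have [ps _] := dP s sd; case/andP: sd => s_gt0 _.
  by rewrite !hornerMX mulr0 mul0r mulf_neq0 // gt_eqF.
move=> _; have [b bP] := poly_disk_bound p 1.
have b_ge0 : 0 <= b by apply: le_trans (bP 0 _); rewrite ?normr0.
have c_gt0 : 0 < `|c| by rewrite normr_gt0.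
exists (Num.min 1 (`|c| / (b + 1))).
  by rewrite lt_min ltr01 divr_gt0 // ltr_wpDl.
move=> s /andP[s_gt0]; rewrite lt_min => /andP[s1].
rewrite ltr_pdivlMr ?ltr_wpDl // => sc.
have psc : `|p.[s] * s| < `|c|.
  rewrite normrM (gtr0_norm s_gt0) mulrC (le_lt_trans _ sc) // ler_pM2l //.
  by rewrite (le_trans (bP s _)) ?lerDl // gtr0_norm // ltW.
rewrite !hornerMXaddC mulr0 add0r; split.
  apply: contraTneq psc => /eqP; rewrite addr_eq0 => /eqP ->.
  by rewrite normrN ltxx.
rewrite mulrDr addrC -lerBlDr sub0r.
have -> : c * c = `|c| * `|c| by rewrite -!expr2 real_normK ?num_real.
by rewrite (le_trans (ler_norm _)) // normrN normrM ler_pM2l // ltW.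
Qed.

(** A single [s] thus acts as an infinitesimal for a whole finite family. *)
Lemma poly_signs_near0 (R : realFieldType) (I : finType) (p : I -> {poly R}) :
  exists2 s, 0 < s & forall i, p i != 0 ->
    (p i).[s] != 0 /\ 0 <= (p i).[0] * (p i).[s].
Proof.
have dP i : exists d, 0 < d /\ forall s, 0 < s < d -> p i != 0 ->
    (p i).[s] != 0 /\ 0 <= (p i).[0] * (p i).[s].
  have [->|pi] := eqVneq (p i) 0; first by exists 1; split.
  by have [d d0 dP] := poly_sign_near0 pi; exists d; split => // s sd _; apply: dP.
have [d d_min] := fin_all_exists dP.
pose e := \big[Num.min/1]_i d i.
have e_gt0 : 0 < e.
  rewrite /e; elim/big_rec: _ => // i x _ x_gt0.
  by rewrite lt_min x_gt0 (d_min i).1.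
exists (e / 2); first by rewrite divr_gt0.
move=> i pi; apply: (d_min i).2 => //; rewrite divr_gt0 //=.
have le_e : e <= d i by rewrite /e (bigD1 i) //= ge_min lexx.
by apply: lt_le_trans le_e; rewrite ltr_pdivrMr // ltr_pMr // ltr1n.
Qed.

(** Take a point [(1, s, s^2, ...)] of the moment curve: pairing it with [z i] evaluates at [s] the
    polynomial whose coefficients are the entries of [z i]. *)
Lemma generic_vector (R : realFieldType) (I : finType) n (z : I -> 'cV[R]_n) :
  exists q : 'rV_n, forall i, z i != 0 -> (q *m z i) 0 0 != 0.
Proof.
pose p i := \sum_j z i j 0 *: 'X^j.
have [s _ sP] := poly_signs_near0 p.
exists (\row_j s ^+ j) => i zi.
have pz j : (p i)`_(nat_of_ord j) = z i j 0.
  rewrite coef_sum (bigD1 j) //= coefZ coefXn eqxx mulr1 big1 ?addr0 // => k kj.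
  by rewrite coefZ coefXn eq_sym (inj_eq (@ord_inj n)) (negPf kj) mulr0.
have /sP[] : p i != 0.
  apply: contraNneq zi => p0; apply/eqP/colP => j.
  by rewrite -pz p0 coef0 mxE.
move=> psi _; move: psi; congr (_ != 0).
rewrite horner_sum mxE; apply: eq_bigr => j _.
by rewrite hornerZ hornerXn mxE mulrC.
Qed.

(** * Increasing enumerations of sets of rows *)

Section Increasing.
Variables (m n : nat).
Implicit Types f g : {ffun 'I_n -> 'I_m}.

(** A set of rows is indexed by one function for each ordering; this selects one of them, so that no
    cone is counted twice. *)
Definition increasing f := [forall i : 'I_n, forall j : 'I_n, (i < j) ==> (f i < f j)]%N.

Lemma increasing_codom_inj f g :
  increasing f -> increasing g -> codom f =i codom g -> f = g.
Proof.
have sorted_codom h : increasing h -> sorted ltn (map val (codom h)).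
  move=> /forallP incr; rewrite codomE -map_comp.
  have : sorted ltn (map val (enum 'I_n)) by rewrite val_enum_ord iota_ltn_sorted.
  rewrite !sorted_map; apply: sub_sorted => i j /= ij.
  by have /forallP/(_ j)/implyP := incr i; apply.
move=> /sorted_codom sf /sorted_codom sg fg.
have : map val (codom f) = map val (codom g).
  apply: (irr_sorted_eq ltn_trans ltnn sf sg) => k.
  by apply/mapP/mapP => -[i fi ->]; exists i => //; rewrite ?fg // -fg.
move/(inj_map val_inj); rewrite !codomE => /eq_in_map e.
by apply/ffunP => i; apply: e; rewrite mem_enum.
Qed.

Lemma increasing_perm f : injective f ->
  exists s : 'S_n, increasing [ffun i => f (s i)].
Proof.
move=> f_inj; pose t := [tuple f i | i < n].
pose leqo := relpre (@nat_of_ord m) leq.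
have : perm_eq (sort_tuple leqo t) t by rewrite /= perm_sort.
case/tuple_permP => s ts; exists s.
have st : sorted leqo (sort leqo t) by apply: sort_sorted => i j; apply: leq_total.
apply/forallP => i; apply/forallP => j; apply/implyP => ij; rewrite !ffunE.
rewrite ltn_neqAle; apply/andP; split.
  by rewrite (inj_eq (@ord_inj m)) (inj_eq f_inj) (inj_eq perm_inj)
    -(inj_eq (@ord_inj n)) neq_ltn ij.
have nthE k : nth (f i) (sort leqo t) (nat_of_ord k) = f (s k).
  rewrite ts -tnth_nth; rewrite !tnth_mktuple //.
rewrite -!nthE.
have tr : transitive leqo by move=> a b c; apply: leq_trans.
have rf : reflexive leqo by move=> a; apply: leqnn.
apply: (sorted_leq_nth tr rf) => //; rewrite ?inE ?size_sort ?size_tuple //.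
exact: ltnW.
Qed.

End Increasing.

(** * Half-open simplicial cones *)

Lemma col_mulmx (R : pzSemiRingType) m n p (A : 'M[R]_(m, n)) (B : 'M_(n, p)) i :
  col i (A *m B) = A *m col i B.
Proof. by rewrite !colE mulmxA. Qed.

Section HalfOpenFan.
Variables (R : realFieldType) (m n : nat) (V : 'M[R]_(m, n)).
Implicit Types (x y q : 'rV[R]_n) (f g : {ffun 'I_n -> 'I_m}).

Definition coords f x : 'rV[R]_n := x *m invmx (rowsub f V).

(* The coordinates of [x] in the basis [f], or, when [f] does not index a basis,
   linear forms vanishing on its span. *)
Let form f := if rowsub f V \in unitmx then invmx (rowsub f V) else cokermx (rowsub f V).

Let avoiding q := forall f i, col i (form f) != 0 -> (q *m form f) 0 i != 0.

Lemma avoiding_exists : exists q, avoiding q.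
Proof.
have [q qP] := @generic_vector R ({ffun 'I_n -> 'I_m} * 'I_n)%type n
  (fun fi => col fi.2 (form fi.1)).
exists q => f i /(qP (f, i)); rewrite /= -col_mulmx mxE //.
Qed.

Lemma avoidingN q : avoiding q -> avoiding (- q).
Proof. by move=> qP f i /qP; rewrite mulNmx [in X in _ -> X]mxE oppr_eq0. Qed.

(** The span of dependent rows is killed by their cokernel, which has a nonzero column; an inverse
    matrix has no zero column. *)
Lemma avoiding_generic q : avoiding q -> generic V q.
Proof.
move=> qP f; split; last first.
  move=> uM i; have := qP f i; rewrite /form uM; apply.
  apply/eqP => ci0.
  have := congr1 (mulmx (rowsub f V)) ci0.
  rewrite -col_mulmx mulmxV // mulmx0 => /colP/(_ i)/eqP.
  by rewrite !mxE eqxx oner_eq0.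
move=> qf; apply: contraT => nuM.
have : cokermx (rowsub f V) != 0 by rewrite cokermx_eq0 row_full_unit.
case/matrix0Pn => k [i ki].
have : (q *m form f) 0 i != 0.
  apply: qP; rewrite /form (negPf nuM).
  by apply: contraNneq ki => /colP/(_ k); rewrite !mxE => ->.
rewrite /form (negPf nuM).
by move: qf; rewrite submxE => /eqP ->; rewrite mxE eqxx.
Qed.

Lemma avoiding_coords q f i : avoiding q -> rowsub f V \in unitmx -> coords f q 0 i != 0.
Proof. by move/avoiding_generic/(_ f) => [_ h] u; apply: h. Qed.

(** For [y = x + s *: q] with [s] infinitesimal, a coordinate of [y] is positive when that of [x]
    is, or when that of [x] is zero and that of [q] is positive. Half-open membership of [x] thus
    becomes strict positivity at a generic point. *)
Lemma perturbation q x : avoiding q -> exists2 y, generic V y &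
  forall f i, rowsub f V \in unitmx ->
    (0 < coords f y 0 i) = (0 <= coords f x 0 i) &&
      ((coords f q 0 i < 0) ==> (0 < coords f x 0 i)).
Proof.
move=> qP.
pose p (fi : {ffun 'I_n -> 'I_m} * 'I_n) : {poly R} :=
  ((x *m form fi.1) 0 fi.2)%:P + (q *m form fi.1) 0 fi.2 *: 'X.
have [s s_gt0 sP] := poly_signs_near0 p.
have pE f i a : (p (f, i)).[a] = ((x + a *: q) *m form f) 0 i.
  by rewrite hornerD hornerC hornerZ hornerX mulmxDl -scalemxAl !mxE mulrC.
have p_neq0 f i : col i (form f) != 0 -> p (f, i) != 0.
  move/qP; apply: contraNneq => /(congr1 (fun r : {poly R} => r`_1)).
  by rewrite coefD coefC coefZ coefX coef0 mulr1 add0r => ->.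
exists (x + s *: q).
  apply: avoiding_generic => f i cfi; have [] := sP (f, i) (p_neq0 _ _ cfi).
  by rewrite pE.
move=> f i uM; have qfi := avoiding_coords i qP uM.
have cfi : col i (form f) != 0.
  apply: contraNneq qfi => c0.
  have : q *m col i (form f) = 0 by rewrite c0 mulmx0.
  by rewrite -col_mulmx /form uM => /colP/(_ 0); rewrite !mxE => ->.
have [] := sP (f, i) (p_neq0 _ _ cfi).
rewrite !pE scale0r addr0 /form uM -/(coords f x) -/(coords f (x + s *: q)).
have -> : coords f (x + s *: q) 0 i = coords f x 0 i + s * coords f q 0 i.
  by rewrite /coords mulmxDl -scalemxAl !mxE.
set a := coords f x 0 i; set b := coords f q 0 i in qfi *.
case: (ltrgtP a 0) => [a_lt0|a_gt0|->].
- by rewrite nmulr_rge0 // => _; rewrite ltNge => ->.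
- by rewrite pmulr_rge0 // implybT lt_def => -> ->.
by rewrite add0r pmulr_rgt0 // implybF -leNgt lt_def qfi.
Qed.

Lemma dual_feasible_sort w y f :
    dual_feasible V w f -> (forall i, 0 < coords f y 0 i) ->
  exists g, [/\ increasing g, dual_feasible V w g & forall i, 0 < coords g y 0 i].
Proof.
move=> [uM df] yf.
have f_inj : injective f.
  move=> i j fij; apply/eqP; apply: contraTT uM => ij.
  rewrite -row_free_unit; apply/negP => /row_freeP [W /matrixP MW].
  have := MW i j; have := MW j j; rewrite !mxE eqxx (negPf ij) /=.
  under eq_bigr do rewrite mxE.
  under [X in _ -> X = _ -> _]eq_bigr do rewrite mxE fij.
  by move=> -> /eqP; rewrite oner_eq0.
have [s sP] := increasing_perm f_inj.
set g := [ffun i => f (s i)] in sP.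
have gE p (A : 'M[R]_(m, p)) : rowsub g A = perm_mx s *m rowsub f A.
  by rewrite -row_permE; apply/matrixP => i j; rewrite !mxE ffunE.
have uP : perm_mx s \in @unitmx R n by exact: unitmx_perm.
have uG : rowsub g V \in unitmx by rewrite gE unitmx_mul uP.
have xM (x : 'rV_n) : x *m invmx (rowsub g V) = x *m invmx (rowsub f V) *m invmx (perm_mx s).
  apply: (can_inj (mulmxK uG)); rewrite mulmxKV // gE -!mulmxA (mulmxA (invmx (perm_mx s))).
  by rewrite mulVmx // mul1mx mulVmx // mulmx1.
exists g; split=> //.
  split=> // j jg; rewrite xM gE -!mulmxA (mulmxA (invmx (perm_mx s))).
  rewrite mulVmx // mul1mx mulmxA; apply: df; apply: contra jg => /codomP [i ->].
  by apply/codomP; exists (s^-1%g i); rewrite ffunE permKV.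
move=> i; have := yf (s i); congr (_ < _).
rewrite /coords xM; have -> : invmx (perm_mx s) = perm_mx s^-1%g :> 'M[R]_n.
  apply: (can_inj (mulmxK uP)); rewrite mulVmx // -perm_mxM mulVg perm_mx1 //.
by rewrite -col_permE [RHS]mxE.
Qed.

(* The cells are the cones over the simplices of a regular triangulation of the
   boundary of the convex hull of the rows of [V] and 0; the facets of each cone
   marked by [s] are those separating it from a fixed generic point. *)
Lemma half_open_fan :
    (0 < m)%N -> (forall y, exists2 c : 'rV_m, (forall j, 0 <= c 0 j) & y = c *m V) ->
  exists (T : {pred {ffun 'I_n -> 'I_m}}) (s : {ffun 'I_n -> 'I_m} -> 'I_n -> bool),
  let cell s x f := T f /\ forall i, 0 <= coords f x 0 i /\ (s f i -> 0 < coords f x 0 i) in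
  [/\ forall f, T f -> rowsub f V \in unitmx,
      forall f j, T f -> \sum_i coords f (row j V) 0 i <= 1,
      forall x, exists f, cell s x f /\ (forall g, cell s x g -> g = f)
    & forall x, exists f, cell (fun f i => ~~ s f i) x f].
Proof.
move=> m_gt0 Vpos.
(* Row [j] gets the cost [1 + 'X^(j.+1)]. The distinct exponents exclude ties, since [p (f, j)] has
   coefficient -1 at [j.+1] when [j] is outside [f]; at 0 the polynomial compares the coordinate sum
   of row [j] with 1. *)
pose p (fj : {ffun 'I_n -> 'I_m} * 'I_m) : {poly R} :=
  \sum_i coords fj.1 (row fj.2 V) 0 i *: (1 + 'X^((fj.1 i).+1)) - (1 + 'X^((fj.2).+1)).
have [t t_gt0 tP] := poly_signs_near0 p.
pose w : 'cV[R]_m := \col_j (1 + t ^+ j.+1).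
have w_gt0 j : 0 < w j 0 by rewrite mxE addr_gt0 ?exprn_gt0.
have pE f j : (p (f, j)).[t] = (row j V *m invmx (rowsub f V) *m rowsub f w) 0 0 - w j 0.
  rewrite hornerD horner_sum hornerN !mxE; congr (_ - _); last first.
    by rewrite !hornerE.
  by apply: eq_bigr => i _; rewrite hornerZ !mxE !hornerE.
have p0E f j : (p (f, j)).[0] = \sum_i coords f (row j V) 0 i - 1.
  rewrite hornerD horner_sum hornerN hornerD hornerXn hornerC expr0n addr0.
  by congr (_ - _); apply: eq_bigr => i _; rewrite hornerZ !hornerE expr0n addr0 mulr1.
have p_neq0 f j : j \notin codom f -> p (f, j) != 0.
  move=> jf; apply/eqP => /(congr1 (fun r : {poly R} => r`_j.+1)).
  rewrite coefB coefD coef1 coefXn eqxx coef0 coef_sum big1 => [/eqP|i _].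
    by rewrite /= !add0r oppr_eq0 oner_eq0.
  rewrite coefZ coefD coef1 coefXn /= add0r eqSS (inj_eq (@ord_inj m)).
  by rewrite (_ : (j == f i) = false) ?mulr0 //; apply: contraNF jf => /eqP ->; apply: codom_f.
have [q qP] := avoiding_exists.
pose T f := increasing f && (rowsub f V \in unitmx) && [forall j, (j \notin codom f) ==>
  ((row j V *m invmx (rowsub f V) *m rowsub f w) 0 0 < w j 0)].
have TP f : reflect (increasing f /\ dual_feasible V w f) (T f).
  apply: (iffP idP) => [/andP[/andP[incf uM] /forallP h]|[incf [uM h]]].
    by split=> //; split=> // j jf; have := h j; rewrite jf.
  by rewrite /T incf uM; apply/forallP => j; apply/implyP; exact: h.
have cellP q' x : avoiding q' -> exists f, T f /\
    forall i, 0 <= coords f x 0 i /\ (coords f q' 0 i < 0 -> 0 < coords f x 0 i).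
  move=> qP'; have [y gy yP] := perturbation x qP'; have [c c_ge0 yc] := Vpos y.
  have [|f df yf] := dual_feasible_exists w_gt0 _ gy m_gt0 c_ge0 yc.
    move=> f uM j jf; have [] := tP (f, j) (p_neq0 _ _ jf).
    by rewrite pE subr_eq0.
  have [g [ig dg yg]] := dual_feasible_sort df yf.
  exists g; split; first exact/TP.
  move=> i; have := yg i; rewrite yP; last by case: dg.
  by case/andP => -> /implyP.
exists T, (fun f i => coords f q 0 i < 0); split.
- by move=> f /TP[_ []].
- move=> f j /TP[_ [uM df]]; case: (boolP (j \in codom f)) => jf.
    have [i _ ->] := row_codom_ffun V jf.
    rewrite (bigD1 i) //= /coords -row_mul mulmxV // !mxE eqxx big1 ?addr0 //.
    by move=> k ki; rewrite !mxE eq_sym (negPf ki).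
  (* Strict negativity at [t] becomes a weak inequality at 0 through the sign condition. *)
  have [pt] := tP (f, j) (p_neq0 _ _ jf); have := df j jf.
  rewrite -subr_lt0 -pE => pt_lt0.
  by rewrite nmulr_lge0 // p0E subr_le0.
(* One perturbation [y] of [x] is positive in both bases, so duality identifies their sets of rows
   and monotonicity then identifies the functions. *)
- move=> x; have [f [Tf fP]] := cellP q x qP; exists f; split => // g [Tg gP].
  have [y gy yP] := perturbation x qP.
  case/TP: Tf => incf df; case/TP: Tg => incg dg.
  have pos h : dual_feasible V w h ->
      (forall i, 0 <= coords h x 0 i /\ (coords h q 0 i < 0 -> 0 < coords h x 0 i)) ->
      forall i, 0 < coords h y 0 i.
    move=> dh hP i; rewrite yP; last by case: dh.
    by have [-> /implyP] := hP i.
  apply: increasing_codom_inj => //.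
  exact: (dual_feasible_codom dg df (pos g dg gP) (pos f df fP)).
(* The facets left unmarked by [q] are those on which its coordinate is positive, so they are the
   ones marked by [- q]. *)
move=> x; have [f [Tf fP]] := cellP _ x (avoidingN qP); exists f; split => // i.
have [-> h] := fP i; split=> // qfi; apply: h.
rewrite /coords mulNmx mxE oppr_lt0 lt_def leNgt qfi andbT.
by apply: avoiding_coords qP _; case/TP: Tf => _ [].
Qed.

End HalfOpenFan.

(** * Reciprocity for half-open cones *)

Section Counting.

(** Stars and bars: the entries of a tuple of sum at most [K] are at most [K]. The wider range given
    by [k] lets tuples with different bounds share one type. *)
Lemma card_tuple_sum_leq n k K : (K <= k)%N ->
  #|[pred t : n.-tuple 'I_k.+1 | \sum_i tnth t i <= K]%N| = 'C(K + n, n).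
Proof.
move=> leKk; rewrite addnC -card_partial_ord_partitions.
pose h (t : n.-tuple 'I_K.+1) : n.-tuple 'I_k.+1 := map_tuple (widen_ord (leKk : K < k.+1)%N) t.
have h_inj : injective h.
  move=> t u /(congr1 val) /= /inj_map e; apply: val_inj; apply: e => i j /(congr1 val) /= ij.
  exact: val_inj.
rewrite -(card_imset _ h_inj); apply: eq_card => t; rewrite !inE; apply/idP/imsetP.
  move=> tK.
  have t_le i : (tnth t i <= K)%N.
    by apply: leq_trans tK; rewrite (bigD1 i) //= leq_addr.
  exists (map_tuple (fun a : 'I_k.+1 => inord a : 'I_K.+1) t).
    rewrite inE big_tuple (leq_trans _ tK) //; apply: leq_sum => i _.
    by rewrite tnth_map inordK // ltnS t_le.
  apply: eq_from_tnth => i; rewrite !tnth_map; apply: val_inj => /=.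
  by rewrite inordK // ltnS t_le.
case=> u; rewrite inE big_tuple => uK ->; rewrite (leq_trans _ uK) //.
by apply: leq_sum => i _; rewrite tnth_map.
Qed.

Lemma card_tuple_sum_shift n k c : (c <= n)%N ->
  #|[pred t : n.-tuple 'I_k.+1 | \sum_i tnth t i + c <= k]%N| = 'C(k + n - c, n).
Proof.
move=> cn; case: (leqP c k) => ck.
  rewrite -addnBAC // -(@card_tuple_sum_leq n k) ?leq_subr //.
  by apply: eq_card => t; rewrite !inE leq_subRL // addnC.
rewrite bin_small; last lia.
by apply: eq_card0 => t; rewrite !inE leqNgt (leq_trans ck) // leq_addl.
Qed.

Variable R : numFieldType.

Lemma prod_falling (a n : nat) : \prod_(j < n) (a%:R - j%:R) = (a ^_ n)%:R :> R.
Proof.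
elim: n => [|n IH]; first by rewrite big_ord0 ffactn0.
rewrite big_ord_recr /= IH ffactnSr natrM; case: (leqP n a) => [na|an].
  by rewrite natrB.
by rewrite ffact_small // !mul0r.
Qed.

(* The binomial coefficient C(X + n - c, n). *)
Definition bin_poly n c : {poly R} :=
  n`!%:R^-1 *: \prod_(j < n) ('X - (c%:R + j%:R - n%:R)%:P).

Lemma size_bin_poly n c : (size (bin_poly n c) <= n.+1)%N.
Proof.
rewrite (leq_trans (size_scale_leq _ _)) //.
by rewrite size_prod_XsubC /index_enum -enumT size_enum_ord.
Qed.

Lemma falling_bin (a n : nat) : n`!%:R^-1 * (a ^_ n)%:R = 'C(a, n)%:R :> R.
Proof. by rewrite -bin_ffact natrM mulrC mulfK // pnatr_eq0 -lt0n fact_gt0. Qed.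

Lemma horner_bin_poly n c k : (c <= n)%N ->
  (bin_poly n c).[k%:R] = 'C(k + n - c, n)%:R.
Proof.
move=> cn; rewrite hornerZ horner_prod -falling_bin -prod_falling; congr (_ * _).
apply: eq_bigr => j _; rewrite !hornerE natrB ?natrD; first ring.
by rewrite (leq_trans cn) // leq_addl.
Qed.

(** Changing the sign of the [n] factors and reversing their order turns the product at [- k] into a
    falling factorial of [k + c - 1]. *)
Lemma horner_bin_polyN n c k : (c <= n)%N -> (0 < k)%N ->
  (-1) ^+ n * (bin_poly n c).[- k%:R] = 'C(k + c - 1, n)%:R.
Proof.
move=> cn k0; rewrite hornerZ horner_prod -falling_bin -prod_falling mulrCA; congr (_ * _).
rewrite -[in X in X * _](card_ord n) -prodr_const -big_split /= (reindex_inj rev_ord_inj) /=.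
apply: eq_bigr => j _; rewrite !hornerE !natrB ?natrD ?ltn_ord ?addn_gt0 ?k0 //.
by rewrite -natr1; ring.
Qed.

End Counting.

Section Reciprocity.

(** The quotient [(S + N) %/ N.+1] is [S / N.+1] rounded up. *)
Lemma leq_add_ceil N S T k :
  (N.+1 * T + S <= N.+1 * k)%N = (T + (S + N) %/ N.+1 <= k)%N.
Proof.
rewrite -divnMDl // -[in RHS]ltnS ltn_divLR // mulSn; lia.
Qed.

Variables (R : numFieldType) (F : finType) (T : pred F) (n N : nat).
Local Notation residues := {ffun 'I_n -> 'I_N.+1}.
Variables (s : F -> 'I_n -> bool) (Phi Phi' : pred (F * residues)).
(** Reflecting a fundamental parallelepiped in its centre replaces a residue [r] by [N - r] and
    exchanges its open and closed facets. *)
Hypothesis PhiE : forall f r, Phi' (f, r) = Phi (f, [ffun i => rev_ord (r i)]).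

Definition shifted_sum (s : F -> 'I_n -> bool) (fr : F * residues) :=
  (\sum_i (fr.2 i + s fr.1 i))%N.

(* (f, r, t) encodes the point with coordinates t_i + (r_i + s f i) / (N + 1) in
   the cone f, whose i-th coordinate has to be positive when [s f i]. *)
Definition cell_points k := [pred x : F * residues * n.-tuple 'I_k.+1 |
  (T x.1.1 && Phi x.1) &&
  (N.+1 * \sum_i tnth x.2 i + shifted_sum s x.1 <= N.+1 * k)%N].

Definition dual_cell_points k := [pred x : F * residues * n.-tuple 'I_k.+1 |
  (T x.1.1 && Phi' x.1) && (N.+1 * \sum_i tnth x.2 i +
     shifted_sum (fun f i => ~~ s f i) x.1 < N.+1 * k)%N].

Lemma card_dep_pair (I J : finType) (P : pred I) (Q : I -> pred J) :
  #|[pred x : I * J | P x.1 && Q x.1 x.2]| = (\sum_(i | P i) #|[pred j | Q i j]|)%N.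
Proof.
rewrite -sum1_card -(pair_big_dep P Q (fun _ _ => 1%N)).
by apply: eq_bigr => i _; rewrite -sum1_card.
Qed.

(** For a fixed cone and residue vector, the points correspond to tuples of sum at most [k - c],
    where [c] is the shift rounded up, and these are counted by C(k + n - c, n). Reciprocity for
    binomials, after reversing the residues, gives the dual count. *)
Lemma cell_points_reciprocity : exists p : {poly R},
  [/\ (size p <= n.+1)%N, forall k, p.[k%:R] = #|cell_points k|%:R
    & forall k, (0 < k)%N -> (-1) ^+ n * p.[- k%:R] = #|dual_cell_points k|%:R].
Proof.
pose c fr := ((shifted_sum s fr + N) %/ N.+1)%N.
have sum_le fr : (shifted_sum s fr <= N.+1 * n)%N.
  rewrite mulnC -[X in (_ <= X * _)%N]card_ord -sum_nat_const; apply: leq_sum => i _.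
  by have := ltn_ord (fr.2 i); case: (s _ _) => /= ?; lia.
have c_le fr : (c fr <= n)%N.
  by have := leq_add_ceil N (shifted_sum s fr) 0 n; rewrite muln0 !add0n sum_le.
exists (\sum_(fr : F * residues | T fr.1 && Phi fr) bin_poly R n (c fr)); split.
- apply: leq_trans (size_sum _ _ _) _; apply/bigmax_leqP => fr _.
  exact: size_bin_poly.
- move=> k; rewrite horner_sum (card_dep_pair (fun fr => T fr.1 && Phi fr)
    (fun fr (t : n.-tuple 'I_k.+1) =>
      (N.+1 * \sum_i tnth t i + shifted_sum s fr <= N.+1 * k)%N)) natr_sum.
  apply: eq_bigr => fr _.
  rewrite horner_bin_poly // -card_tuple_sum_shift //; congr (_%:R).
  by apply: eq_card => t; rewrite !inE leq_add_ceil.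
move=> k k_gt0; rewrite horner_sum mulr_sumr.
pose rev (fr : F * residues) : F * residues := (fr.1, [ffun i => rev_ord (fr.2 i)]).
have rev_inj : injective rev.
  move=> [f r] [g r'] [-> e]; congr (_, _); apply/ffunP => i.
  by have /ffunP/(_ i) := e; rewrite !ffunE => /rev_ord_inj.
(* In each coordinate [(N - r) + s] and [r + (1 - s)] add up to [N + 1]. *)
have rev_sum fr : (shifted_sum s (rev fr) + shifted_sum (fun f i => ~~ s f i) fr = N.+1 * n)%N.
  rewrite mulnC -[X in (_ = X * _)%N]card_ord -sum_nat_const -big_split /=; apply: eq_bigr => i _.
  by rewrite ffunE /=; have := ltn_ord (fr.2 i); case: (s _ _) => /= ?; lia.
rewrite (reindex_inj rev_inj) /= (card_dep_pair (fun fr => T fr.1 && Phi' fr)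
  (fun fr (t : n.-tuple 'I_k.+1) => (N.+1 * \sum_i tnth t i +
    shifted_sum (fun f i => ~~ s f i) fr < N.+1 * k)%N)) natr_sum.
apply: eq_big => [[f r]|fr _]; first by rewrite PhiE.
rewrite horner_bin_polyN //; congr (_%:R).
have dual_le t : (N.+1 * t + shifted_sum (fun f i => ~~ s f i) fr < N.+1 * k)%N =
    (t + n < k + c (rev fr))%N.
  rewrite [RHS]ltnNge -leq_add_ceil -ltnNge mulnDr -(rev_sum fr); lia.
rewrite [in RHS](@eq_card _ _ [pred t : n.-tuple 'I_k.+1 |
  \sum_i tnth t i + n < k + c (rev fr)]%N); last by move=> t; rewrite !inE dual_le.
(* In the first case the bound reads sum [<= k + c - n - 1], which is at most [k] because [c <= n];
   in the second no tuple qualifies and the binomial vanishes. *)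
case: (ltnP n (k + c (rev fr))) => nk.
  have -> : (k + c (rev fr) - 1 = k + c (rev fr) - n.+1 + n)%N by lia.
  rewrite -(@card_tuple_sum_leq n k); last by have := c_le (rev fr); lia.
  by apply: eq_card => t; rewrite !inE; apply/idP/idP; lia.
rewrite bin_small; last lia.
by apply/esym/eq_card0 => t; rewrite !inE; apply/negbTE; lia.
Qed.

End Reciprocity.

(** * Real roots in dimension at most three *)

Section RootBound.
Variable R : realType.
Implicit Types p : {poly R}.

Lemma coef_top_ge0 p n :
  (size p <= n.+1)%N -> (forall k : nat, 0 <= p.[k%:R]) -> 0 <= p`_n.
Proof.
rewrite leq_eqVlt => /orP[/eqP sp|sp _]; last by rewrite nth_default.
move=> p_ge0; have -> : p`_n = lead_coef p by rewrite lead_coefE sp.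
rewrite leNgt -oppr_gt0 -lead_coefN; apply/negP => /[dup] l_gt0.
case/poly_pinfty_gt_lc => b bP.
have [k bk] : exists k : nat, b <= k%:R.
  by exists (Num.bound `|b|); rewrite ltW // (le_lt_trans (ler_norm b)) // archi_boundP.
have := bP _ bk; rewrite hornerN => /(lt_le_trans l_gt0).
by rewrite oppr_gt0 ltNge p_ge0.
Qed.

Lemma quadratic_top_ge0 (a b c : R) :
  (forall k : nat, 0 <= a * k%:R ^+ 2 + b * k%:R + c) -> 0 <= a.
Proof.
move=> abc_ge0; have := @coef_top_ge0 (Poly [:: c; b; a]) 2 (size_Poly _).
rewrite coef_Poly; apply => k; rewrite horner_Poly /=.
by rewrite -[X in 0 <= X](_ : a * k%:R ^+ 2 + b * k%:R + c = _) //; ring.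
Qed.

(** If [x < -1] and the leading coefficient is positive, [(-1)^n p(x)] is a sum of nonnegative
    terms, one of them positive. If that coefficient is zero, the inequalities and the root make all
    coefficients vanish. *)
Lemma root_ge_N1 n p (x : R) :
    n \in [:: 1; 2; 3]%N -> (size p <= n.+1)%N -> p != 0 ->
    (forall k : nat, 0 <= p.[k%:R]) -> 0 <= (-1) ^+ n * p.[-1] ->
    (forall k : nat, p.[k.+1%:R] <= (-1) ^+ n * p.[- k.+2%:R]) ->
  root p x -> -1 <= x.
Proof.
move=> n123 sp p_neq0 p_ge0 pN1 dual /rootP px0; rewrite leNgt; apply/negP => x_lt.
have hE y : p.[y] = \sum_(i < n.+1) p`_i * y ^+ i by exact: horner_coef_wide.
have a0_ge0 : 0 <= p`_0 by rewrite -horner_coef0; exact: (p_ge0 0%N).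
have top_ge0 := coef_top_ge0 sp p_ge0.
have coef0P : (forall i : 'I_n.+1, p`_i = 0) -> False.
  move=> ai0; move/eqP: p_neq0; apply; apply/polyP => i; rewrite coef0.
  case: (ltnP i n.+1) => iN; first exact: (ai0 (Ordinal iN)).
  by rewrite nth_default // (leq_trans sp).
have zero_top m : n = m.+1 -> p`_n = 0 -> (size p <= m.+1)%N.
  move=> nm an0; apply/leq_sizeP => i; rewrite leq_eqVlt -nm => /orP[/eqP <- //|ni].
  by rewrite nth_default // (leq_trans sp).
move: n123; rewrite !inE => /or3P[] /eqP n_eq; subst n.
- move: pN1 px0; rewrite !hE !big_ord_recr !big_ord0 /= !add0r !expr0 !expr1 !mulr1.
  move=> pN1 px0; have a1 : p`_1 = 0 by nra.
  have a0 : p`_0 = 0 by nra.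
  by apply: coef0P => -[[|[|i]]].
(* At [k = 0] the hypothesis [dual] reads p(1) <= p(-2), that is 3 a_1 <= 3 a_2. *)
- have a21 : p`_1 <= p`_2.
    have := dual 0%N; rewrite !hE !big_ord_recr !big_ord0 /= => h; lra.
  have [a2_eq|a2_neq] := eqVneq p`_2 0.
    have sp' := zero_top 1%N erefl a2_eq.
    have a1_ge0 := coef_top_ge0 sp' p_ge0.
    have a1 : p`_1 = 0 by lra.
    have a0 : p`_0 = 0.
      by move: px0; rewrite hE !big_ord_recr !big_ord0 /= a2_eq a1; lra.
    by apply: coef0P => -[[|[|[|i]]]].
  have a2_gt0 : 0 < p`_2 by rewrite lt_def a2_neq.
  move: px0; rewrite hE !big_ord_recr !big_ord0 /= => px0.
  have : 0 < p`_2 * (x * (x + 1)) by rewrite mulr_gt0 // nmulr_rgt0 //; lra.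
  have : 0 <= (p`_2 - p`_1) * - x by rewrite mulr_ge0 //; lra.
  lra.
(* The quadratic in [k] is -p(-k-2) - p(k+1), with leading coefficient 3 a_3 - 2 a_2. *)
have a32 : 0 <= 3 * p`_3 - 2 * p`_2.
  apply: (@quadratic_top_ge0 _ (9 * p`_3 - 6 * p`_2)
    (7 * p`_3 - 5 * p`_2 + p`_1 - 2 * p`_0)) => k.
  have := dual k; rewrite !hE !big_ord_recr !big_ord0 /= -subr_ge0.
  rewrite -(natr1 k.+1) -(natr1 k); congr (0 <= _); ring.
have H1 : 0 <= p`_3 - p`_2 + p`_1 - p`_0.
  by move: pN1; rewrite !hE !big_ord_recr !big_ord0 /=; lra.
have : (- x) * (- x - 1) * (p`_3 * (1 - x) - p`_2) +
    - x * (p`_3 - p`_2 + p`_1 - p`_0) + (- x - 1) * p`_0 = 0.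
  by move: px0; rewrite hE !big_ord_recr !big_ord0 /=; lra.
have xx_gt0 : 0 < (- x) * (- x - 1) by rewrite mulr_gt0 //; lra.
have t2 : 0 <= - x * (p`_3 - p`_2 + p`_1 - p`_0) by rewrite mulr_ge0 //; lra.
have t3 : 0 <= (- x - 1) * p`_0 by rewrite mulr_ge0 //; lra.
have [a3_eq|a3_neq] := eqVneq p`_3 0.
  have sp' := zero_top 2%N erefl a3_eq.
  have a2_ge0 := coef_top_ge0 sp' p_ge0.
  have a2 : p`_2 = 0 by lra.
  rewrite a3_eq a2 mul0r subrr mulr0 add0r => e.
  have : (- x - 1) * p`_0 = 0 by move: e t2 t3; rewrite a3_eq a2; lra.
  move/eqP; rewrite mulf_eq0 => /orP[/eqP|/eqP a0]; first lra.
  have : - x * p`_1 = 0 by move: e; rewrite a0; lra.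
  move/eqP; rewrite mulf_eq0 => /orP[/eqP|/eqP a1]; first lra.
  by apply: coef0P => -[[|[|[|[|i]]]]].
have a3_gt0 : 0 < p`_3 by rewrite lt_def a3_neq.
have : 0 < (- x) * (- x - 1) * (p`_3 * (1 - x) - p`_2).
  (* By [a32], a_2 <= (3/2) a_3 <= 2 a_3, while [1 - x > 2]. *)
  rewrite mulr_gt0 // subr_gt0 (@lt_le_trans _ _ (p`_3 * 2)) //; first lra.
  by rewrite ler_pM2l //; lra.
lra.
Qed.

End RootBound.

(** * Convex hulls of rows of a matrix *)

Section Hulls.
Local Open Scope classical_set_scope.
Variables (R : realType) (n : nat).
Implicit Types (A C P : set 'rV[R]_n).

Lemma convex_setE A : convex_set (A : set (convex_lmodType 'rV[R]_n)) <->
  forall x y (t : R), 0 <= t <= 1 -> A x -> A y -> A (t *: x + (1 - t) *: y).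
Proof.
split=> [cA x y t t01 Ax Ay|cA x y l /set_mem Ax /set_mem Ay].
  have /andP[t0 t1] := t01.
  have := cA x y (Itv01 t0 t1); rewrite !inE => /(_ Ax Ay).
  by [].
apply/mem_set; apply: cA => //.
by apply/andP; split.
Qed.

Definition conv_mx m (V : 'M[R]_(m, n)) : set 'rV[R]_n :=
  [set x | exists c : 'rV_m,
    [/\ forall i, 0 <= c 0 i, \sum_i c 0 i = 1 & x = c *m V]].

Lemma conv_mx_row m (V : 'M[R]_(m, n)) i : conv_mx V (row i V).
Proof.
exists (delta_mx 0 i); split; last by rewrite rowE.
  by move=> j; rewrite mxE ler0n.
by rewrite (bigD1 i) //= mxE !eqxx big1 ?addr0 // => j /negPf ji; rewrite mxE ji andbF.
Qed.

Lemma conv_mx_convex m (V : 'M[R]_(m, n)) x y t : 0 <= t <= 1 ->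
  conv_mx V x -> conv_mx V y -> conv_mx V (t *: x + (1 - t) *: y).
Proof.
move=> /andP[t0 t1] [c [c0 c1 ->]] [d [d0 d1 ->]].
exists (t *: c + (1 - t) *: d); split; last by rewrite mulmxDl -!scalemxAl.
  by move=> i; rewrite !mxE addr_ge0 // mulr_ge0 // subr_ge0.
under eq_bigr do rewrite !mxE.
by rewrite big_split /= -!mulr_sumr c1 d1 !mulr1 addrC subrK.
Qed.

Lemma mulmx_row' m (V : 'M[R]_(m.+1, n)) i0 (c : 'rV_m.+1) :
  c *m V = c 0 i0 *: row i0 V + (col' i0 c) *m (row' i0 V).
Proof.
rewrite !mulmx_sum_row (bigD1_ord i0) //=; congr (_ + _).
by apply: eq_bigr => i _; rewrite !mxE; congr (_ *: _); apply/rowP => j; rewrite !mxE.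
Qed.

(** Split off the first row: the other rows carry total weight [s] and, unless [s = 0], their
    renormalised combination lies in [C] by induction. *)
Lemma conv_mx_min m (V : 'M[R]_(m, n)) C :
  (forall x y (t : R), 0 <= t <= 1 -> C x -> C y -> C (t *: x + (1 - t) *: y)) ->
  (forall i, C (row i V)) -> conv_mx V `<=` C.
Proof.
move=> cC; elim: m V => [|m IH] V CV x [c [c_ge0 c_sum ->]].
  by move/eqP: c_sum; rewrite big_ord0 eq_sym oner_eq0.
rewrite (mulmx_row' V ord0).
move: c_sum; rewrite (bigD1_ord ord0) //= => c_sum.
set s := \sum_i _ in c_sum.
have s_ge0 : 0 <= s by apply: sumr_ge0.
have c0E : c 0 ord0 = 1 - s by rewrite -c_sum addrK.
have [s0|s_neq0] := eqVneq s 0.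
  rewrite c0E s0 subr0 scale1r (_ : col' _ c = 0) ?mul0mx ?addr0 //.
  apply/rowP => i; rewrite !mxE; apply/eqP.
  by have := psumr_eq0P _ s0; rewrite /= => -> //.
have -> : col' ord0 c = s *: (s^-1 *: col' ord0 c) by rewrite scalerA divff ?scale1r.
rewrite addrC -scalemxAl c0E; apply: cC => //.
  by rewrite s_ge0 /= -subr_ge0 -c0E.
apply: (IH (row' ord0 V)) => [i|].
  have -> : row i (row' ord0 V) = row (lift ord0 i) V by apply/rowP => j; rewrite !mxE.
  exact: CV.
exists (s^-1 *: col' ord0 c); split=> //.
  by move=> i; rewrite !mxE mulr_ge0 ?invr_ge0.
under eq_bigr do rewrite !mxE.
by rewrite -mulr_sumr mulVf.
Qed.

Lemma convex_hullE (s : seq 'rV[R]_n) :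
  convex_hull [set` s] = conv_mx (\matrix_(i < size s) s`_i).
Proof.
apply/seteqP; split.
  apply: smallest_sub; first by apply/convex_setE => *; apply: conv_mx_convex.
  move=> x /= xs; have xs' : (index x s < size s)%N by rewrite index_mem.
  have := conv_mx_row (\matrix_(i < size s) s`_i) (Ordinal xs').
  by rewrite rowK /= nth_index.
apply: conv_mx_min => [x y t t01 hx hy C [/= cC sC]|i C [_ sC]].
  by move/convex_setE: (cC); apply => //; [apply: hx|apply: hy].
by rewrite rowK; apply: sC; rewrite /= mem_nth.
Qed.

Lemma conv_mx_drop m (V : 'M[R]_(m.+1, n)) i0 :
  conv_mx (row' i0 V) (row i0 V) -> conv_mx V = conv_mx (row' i0 V).
Proof.
have row'E i : row i (row' i0 V) = row (lift i0 i) V.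
  by apply/rowP => j; rewrite !mxE.
move=> h; apply/seteqP; split; apply: conv_mx_min => [*|i].
- exact: conv_mx_convex.
- by case: (unliftP i0 i) => [j|] -> //; rewrite -row'E; exact: conv_mx_row.
- exact: conv_mx_convex.
by rewrite row'E; exact: conv_mx_row.
Qed.

(** Contrapositively, let row [i0] lie outside the hull of the other rows. A convex combination
    equal to it must have weight 1 on [i0], or it could be solved for that row; hence both ends of a
    segment through it also have weight 1 there. *)
Lemma non_vertex_drop m (V : 'M[R]_(m.+1, n)) i0 :
  ~ vertex (conv_mx V) (row i0 V) -> conv_mx (row' i0 V) (row i0 V).
Proof.
set v := row i0 V; move=> nv; apply: contrapT => ndrop; apply: nv.
split; first exact: conv_mx_row.
move=> _ _ t [c [c0 c1 ->]] [d [d0 d1 ->]] /andP[t_gt0 t_lt1] vE.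
pose e := t *: c + (1 - t) *: d.
have ve : v = e *m V by rewrite mulmxDl -!scalemxAl.
have e_ge0 i : 0 <= e 0 i.
  by rewrite !mxE addr_ge0 // mulr_ge0 // ?subr_ge0 ltW.
have e1 : \sum_i e 0 i = 1.
  under eq_bigr do rewrite !mxE.
  by rewrite big_split /= -!mulr_sumr c1 d1 !mulr1 addrC subrK.
have unit_weight (b : 'rV[R]_m.+1) : (forall i, 0 <= b 0 i) -> \sum_i b 0 i = 1 ->
    b 0 i0 = 1 -> b *m V = v.
  move=> b0 b1 bi0; rewrite (mulmx_row' V i0) bi0 scale1r.
  rewrite (_ : col' _ _ = 0) ?mul0mx ?addr0 //; apply/rowP => i; rewrite !mxE.
  move/eqP: b1; rewrite (bigD1_ord i0) //= bi0 -[X in _ == X]addr0 (inj_eq (addrI _)) => /eqP b1.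
  by apply: (psumr_eq0P _ b1).
have ei0 : e 0 i0 = 1.
  apply/eqP; apply: contraT => ei0; exfalso; apply: ndrop.
  move: ve; rewrite (mulmx_row' V i0) -/v => ve.
  have e' : 1 - e 0 i0 != 0 by rewrite subr_eq0 eq_sym.
  have sE : \sum_i e 0 (lift i0 i) = 1 - e 0 i0.
    by rewrite -e1 (bigD1_ord i0) //= addrAC subrr add0r.
  exists ((1 - e 0 i0)^-1 *: col' i0 e); split.
  - move=> i; rewrite mxE [col' _ _ _ _]mxE mulr_ge0 // invr_ge0 -sE sumr_ge0 //.
  - under eq_bigr do rewrite mxE [col' _ _ _ _]mxE.
    by rewrite -mulr_sumr sE mulVf.
  have : (1 - e 0 i0) *: v = col' i0 e *m row' i0 V.
    by rewrite scalerBl scale1r {1}ve addrAC subrr add0r.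
  by rewrite -scalemxAl => <-; rewrite scalerA mulVf // scale1r.
have le1 (b : 'rV[R]_m.+1) : (forall i, 0 <= b 0 i) -> \sum_i b 0 i = 1 -> b 0 i0 <= 1.
  by move=> b0 <-; rewrite (bigD1 i0) //= lerDl sumr_ge0.
have c_le := le1 c c0 c1; have d_le := le1 d d0 d1.
rewrite !mxE in ei0.
by split; apply: unit_weight => //; nra.
Qed.

Lemma conv_mx_vertices m (V : 'M[R]_(m, n)) : exists m' (W : 'M[R]_(m', n)),
  conv_mx V = conv_mx W /\ forall i, vertex (conv_mx W) (row i W).
Proof.
elim: m V => [|m IH] V; first by exists 0%N, V; split => // -[].
have [all_v|] := pselect (forall i, vertex (conv_mx V) (row i V)).
  by exists m.+1, V.
move/existsNP => [i /non_vertex_drop/conv_mx_drop ->]; exact: IH.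
Qed.

(** Integrality is assumed at the vertices, whereas the generators are arbitrary; discarding those
    that are not vertices leaves an integral matrix. *)
Lemma lattice_polytope_conv_mx P : lattice_polytope P ->
  exists m (V : 'M[R]_(m, n)), P = conv_mx V /\ forall i j, V i j \is a Num.int.
Proof.
case=> -[s ->] _; rewrite convex_hullE.
have [m [W [-> Wv]]] := conv_mx_vertices (\matrix_(i < size s) s`_i) => Wint.
by exists m, W; split => // i j; have := Wint _ (Wv i) j; rewrite mxE.
Qed.

Lemma has_full_dim m (V : 'M[R]_(m, n)) : has_dim (conv_mx V) n ->
  (exists x, conv_mx V x) /\ forall y : 'rV_n, (y <= V)%MS.
Proof.
move=> [p [U dimU hullE]].
have UT : U = fullv by apply/eqP; rewrite eqEdim subvf dimvf /dim /= dimU mul1n.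
have hullT y : affine_hull (conv_mx V) y.
  by rewrite hullE; exists (y - p); rewrite /= ?UT ?memvf // addrC subrK.
split.
  (* The empty set is affine, so an empty hull would have an empty affine hull. *)
  apply: contrapT => noV; apply: (hullT 0 set0).
  by split => [x y t []|x Vx]; apply: noV; exists x.
move=> y; apply: (hullT y [set x | (x <= V)%MS]); split => [a b t /= aV bV|x [c [_ _ ->]]].
  by rewrite addmx_sub // scalemx_sub.
exact: submxMl.
Qed.

(** The origin is the midpoint of [x] and [- x]. A linear combination of rows becomes conic when
    each negative coefficient is moved to the opposite of its row, which lies in the hull by
    symmetry. *)
Lemma symmetric_conic_span m (V : 'M[R]_(m, n)) :
  has_dim (conv_mx V) n -> zero_symmetric (conv_mx V) ->
  [/\ (0 < m)%N, conv_mx V 0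
    & forall y, exists2 c : 'rV_m, (forall j, 0 <= c 0 j) & y = c *m V].
Proof.
move=> /has_full_dim [[x Vx] V_span] symV.
have VN z : conv_mx V z -> conv_mx V (- z).
  by rewrite {2}symV => Vz; exists z.
split.
- case: m V x Vx {V_span symV VN} => // V x [c [_ /eqP]].
  by rewrite big_ord0 eq_sym oner_eq0.
- have := conv_mx_convex (t := 2^-1) _ Vx (VN _ Vx); rewrite scalerN -scalerBl.
  have -> : 2^-1 - (1 - 2^-1) = 0 :> R by lra.
  by rewrite scale0r; apply; lra.
move=> y; have /submxP[d ->] := V_span y.
have [N NP] := fin_all_exists (fun j => VN _ (conv_mx_row V j)).
exists (\sum_j (if 0 <= d 0 j then d 0 j *: delta_mx 0 j else (- d 0 j) *: N j)).
  move=> j; rewrite summxE sumr_ge0 // => i _; case: ifPn => di.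
    by rewrite !mxE mulr_ge0 ?ler0n.
  rewrite -ltNge in di; rewrite mxE; have [N_ge0 _ _] := NP i.
  by apply: mulr_ge0 (N_ge0 j); rewrite oppr_ge0 ltW.
rewrite mulmx_suml mulmx_sum_row; apply: eq_bigr => j _; case: ifP => _.
  by rewrite -scalemxAl -rowE.
by have [_ _ Nj] := NP j; rewrite -scalemxAl -Nj scalerN scaleNr opprK.
Qed.

End Hulls.

(** * Lattice points in dilates *)

Section EhrhartCells.
Local Open Scope classical_set_scope.
Local Open Scope card_scope.

Lemma card_eq_finpred (X : finType) (D : pred X) : [set x | D x] #= `I_#|D|.
Proof.
have -> : [set x | D x] = (fun i : 'I_#|D| => enum_val i) @` [set: 'I_#|D|].
  apply/seteqP; split=> x /=; last by case=> i _ <-; exact: enum_valP.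
  by move=> Dx; exists (enum_rank_in (Dx : x \in D) x) => //; rewrite enum_rankK_in.
apply: card_eq_trans (inj_card_eq _) _; first by move=> i j _ _; apply: enum_val_inj.
by rewrite card_eq_sym card_II.
Qed.

Variables (R : realType) (m n : nat) (V : 'M[R]_(m, n)).
Hypothesis V_int : forall i j, V i j \is a Num.int.
Local Notation F := {ffun 'I_n -> 'I_m}.
Implicit Types (f : F) (x : 'rV[R]_n).

(** By Cramer's rule the determinant of a basis clears the denominators of its coordinates; squaring
    makes the product over all bases positive. *)
Lemma common_denominator : exists N : nat, forall f x, rowsub f V \in unitmx ->
  (forall j, x 0 j \is a Num.int) -> forall i, N.+1%:R * coords V f x 0 i \is a Num.int.
Proof.
have det_int p (A : 'M[R]_p) : (forall i j, A i j \is a Num.int) -> \det A \is a Num.int.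
  by move=> Ai; rewrite rpred_sum // => s _; rewrite rpredMsign rpred_prod.
pose d f := if rowsub f V \in unitmx then \det (rowsub f V) else 1.
have d_int f : d f \is a Num.int.
  by rewrite /d; case: ifP => // _; apply: det_int => i j; rewrite mxE.
have d_neq0 f : d f != 0.
  by rewrite /d; case: ifP => [|_]; rewrite ?oner_eq0 // unitmxE unitfE.
have prod_int (Q : pred F) : \prod_(f | Q f) d f ^+ 2 \is a Num.int.
  by rewrite rpred_prod // => f _; rewrite rpredX.
have prod_gt0 : 0 < \prod_f d f ^+ 2.
  by apply: prodr_gt0 => f _; rewrite lt_def sqr_ge0 sqrf_eq0 d_neq0.
have /natrP[[|N] NE] : \prod_f d f ^+ 2 \is a Num.nat.
- by rewrite natrEint prod_int ltW.
- by rewrite NE ltxx in prod_gt0.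
exists N => f x uM x_int i; rewrite -NE (bigD1 f) //=.
have -> : coords V f x = (d f)^-1 *: (x *m \adj (rowsub f V)).
  by rewrite /coords /invmx /d uM scalemxAr.
rewrite mxE; set y := (x *m _) 0 i; set z := \prod_(_ | _) _.
have -> : d f ^+ 2 * z * ((d f)^-1 * y) = d f * z * y by field.
rewrite rpredM // ?rpredM ?prod_int // /y mxE rpred_sum // => j _.
by rewrite rpredM // mxE rpredMsign; apply: det_int => a b; rewrite !mxE.
Qed.

Section Parametrization.
Variables (N : nat).
Hypothesis N_den : forall f x, rowsub f V \in unitmx ->
  (forall j, x 0 j \is a Num.int) -> forall i, N.+1%:R * coords V f x 0 i \is a Num.int.
Local Notation residues := {ffun 'I_n -> 'I_N.+1}.
Variable (s : F -> 'I_n -> bool).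

(** The fraction [(r_i + s_i) / N.+1] runs through [0, 1), or through (0, 1] when facet [i] is
    marked, so the integer part [t_i] is adapted to the half-open cone. *)
Definition cell_point k (y : F * residues * n.-tuple 'I_k.+1) : 'rV[R]_n :=
  (\row_i ((N.+1 * tnth y.2 i + (y.1.2 i + s y.1.1 i))%N%:R / N.+1%:R)) *m rowsub y.1.1 V.

Definition box_integral : pred (F * residues) := fun fr =>
  [forall j, ((\row_i ((fr.2 i + s fr.1 i)%N%:R / N.+1%:R)) *m rowsub fr.1 V) 0 j
     \is a Num.int].

Lemma int_mulmx p (c : 'rV[R]_p) (A : 'M[R]_(p, n)) j :
  (forall i, c 0 i \is a Num.int) -> (forall i j, A i j \is a Num.int) ->
  (c *m A) 0 j \is a Num.int.
Proof. by move=> ci Ai; rewrite mxE rpred_sum // => i _; rewrite rpredM. Qed.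

Let N_neq0 : N.+1%:R != 0 :> R. Proof. by rewrite pnatr_eq0. Qed.

Lemma cell_point_int k (y : F * residues * n.-tuple 'I_k.+1) :
  (forall j, cell_point y 0 j \is a Num.int) <-> box_integral y.1.
Proof.
have -> : cell_point y = (\row_i (tnth y.2 i : nat)%:R) *m rowsub y.1.1 V +
    (\row_i ((y.1.2 i + s y.1.1 i)%N%:R / N.+1%:R)) *m rowsub y.1.1 V.
  rewrite -mulmxDl; congr (_ *m _); apply/rowP => i; rewrite !mxE natrD natrM mulrDl.
  by rewrite mulrAC mulfV // mul1r.
have t_int j : ((\row_i (tnth y.2 i : nat)%:R) *m rowsub y.1.1 V) 0 j \is a Num.int.
  by apply: int_mulmx => [i|a b]; rewrite mxE ?V_int // intr_nat ?natr_nat.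
split=> [h|/forallP h j]; last by rewrite mxE rpredD.
by apply/forallP => j; have := h j; rewrite mxE rpredDl.
Qed.

Lemma coords_cell_point k (y : F * residues * n.-tuple 'I_k.+1) i :
  rowsub y.1.1 V \in unitmx ->
  coords V y.1.1 (cell_point y) 0 i =
  (N.+1 * tnth y.2 i + (y.1.2 i + s y.1.1 i))%N%:R / N.+1%:R.
Proof. by move=> uM; rewrite /coords mulmxK // mxE. Qed.

Lemma sum_coords_cell_point k (y : F * residues * n.-tuple 'I_k.+1) :
  rowsub y.1.1 V \in unitmx ->
  N.+1%:R * \sum_i coords V y.1.1 (cell_point y) 0 i =
  (N.+1 * \sum_i tnth y.2 i + shifted_sum s y.1)%N%:R.
Proof.
move=> uM; rewrite /shifted_sum natrD natrM !natr_sum !mulr_sumr -big_split /=.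
apply: eq_bigr => i _; rewrite coords_cell_point // mulrCA mulfV ?mulr1 //.
by rewrite [in LHS]natrD natrM.
Qed.

(** Divide [N.+1 * x_i - s_i] by [N.+1], where [x_i] is a coordinate of [x] and [s_i] its mark: the
    quotient is [t_i], the remainder [r_i]. Positivity at marked facets makes the subtraction exact,
    and the bound on the sum keeps the quotients below [k.+1]. *)
Lemma cell_point_surj k f x : rowsub f V \in unitmx ->
    (forall j, x 0 j \is a Num.int) ->
    (forall i, 0 <= coords V f x 0 i /\ (s f i -> 0 < coords V f x 0 i)) ->
    \sum_i coords V f x 0 i <= k%:R ->
  exists r t, x = @cell_point k (f, r, t) /\ box_integral (f, r).
Proof.
move=> uM x_int x_cell x_sum.
have a_nat i : exists a : nat, N.+1%:R * coords V f x 0 i = a%:R.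
  apply/natrP; rewrite natrEint N_den // mulr_ge0 //; exact: (x_cell i).1.
have [a aE] := fin_all_exists a_nat.
have s_le i : (s f i <= a i)%N.
  case sf: (s f i) => //; rewrite -(ltr0n R) -aE mulr_gt0 ?ltr0n //.
  exact: (x_cell i).2.
have a_le i : (a i <= N.+1 * k)%N.
  rewrite -(ler_nat R) -aE natrM ler_pM2l ?ltr0n // (le_trans _ x_sum) //.
  by rewrite (bigD1 i) //= lerDl sumr_ge0 // => j _; exact: (x_cell j).1.
pose r : residues := [ffun i => inord ((a i - s f i) %% N.+1)].
pose t : n.-tuple 'I_k.+1 := [tuple inord ((a i - s f i) %/ N.+1) | i < n].
have xE : x = cell_point (f, r, t).
  apply: (can_inj (mulmxKV uM)); apply/rowP => i.
  have -> : (cell_point (f, r, t) *m invmx (rowsub f V)) = coords V f (cell_point (f, r, t)) by [].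
  rewrite coords_cell_point //= tnth_mktuple ffunE !inordK ?ltn_pmod //.
    rewrite addnA mulnC -divn_eq subnK // -aE mulrAC mulfV // mul1r //.
  rewrite ltnS -[X in (_ <= X)%N](@mulKn k N.+1) // leq_div2r //.
  exact: leq_trans (leq_subr _ _) (a_le i).
exists r, t; split=> //; apply/(cell_point_int (f, r, t)).
by rewrite -xE.
Qed.

End Parametrization.

(** The weight missing from 1 is put on the origin. *)
Lemma conv_mx_cone (c : 'rV[R]_n) (f : F) : conv_mx V 0 ->
  (forall i, 0 <= c 0 i) -> \sum_i c 0 i <= 1 -> conv_mx V (c *m rowsub f V).
Proof.
move=> V0 c_ge0 c_sum; have [s0|s_neq0] := eqVneq (\sum_i c 0 i) 0.
  rewrite (_ : c = 0) ?mul0mx //; apply/rowP => i; rewrite mxE.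
  by apply: (psumr_eq0P _ s0).
set s := \sum_i _ in c_sum s_neq0.
have -> : c *m rowsub f V = s *: ((s^-1 *: c) *m rowsub f V) + (1 - s) *: 0.
  by rewrite scaler0 addr0 -scalemxAl scalerA divff // scale1r.
have s_ge0 : 0 <= s by exact: sumr_ge0.
apply: conv_mx_convex => //; first by rewrite s_ge0.
apply: (@conv_mx_min _ _ _ (rowsub f V)) => [*|i|].
- exact: conv_mx_convex.
- by rewrite row_rowsub; exact: conv_mx_row.
exists (s^-1 *: c); split=> //.
  by move=> i; rewrite mxE mulr_ge0 // invr_ge0.
by under eq_bigr do rewrite mxE; rewrite -mulr_sumr mulVf.
Qed.

Lemma mem_dilate k x : (0 < k)%N -> conv_mx V (k%:R^-1 *: x) -> dilate k (conv_mx V) x.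
Proof.
move=> k_gt0 kx; exists (k%:R^-1 *: x) => //.
by rewrite scalerA divff ?scale1r // pnatr_eq0 -lt0n.
Qed.

(** The coordinate sum is a linear form bounded by 1 on the generators, hence on the hull. With
    [conv_mx_cone], it is the gauge on the cone of [f]. *)
Lemma dilate_sum_coords k f x :
    (forall j, \sum_i coords V f (row j V) 0 i <= 1) ->
  dilate k (conv_mx V) x -> \sum_i coords V f x 0 i <= k%:R.
Proof.
move=> sum_le1 [_ [c [c_ge0 c_sum ->]] <-].
have -> : \sum_i coords V f (k%:R *: (c *m V)) 0 i =
    k%:R * \sum_j c 0 j * \sum_i coords V f (row j V) 0 i.
  rewrite /coords -scalemxAl -mulmxA; under eq_bigr do rewrite !mxE.
  rewrite -mulr_sumr exchange_big; congr (_ * _); apply: eq_bigr => j _.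
  by rewrite mulr_sumr; apply: eq_bigr => i _; rewrite -row_mul [in RHS]mxE.
rewrite -[leRHS]mulr1 ler_wpM2l // -c_sum; apply: ler_sum => j _.
by rewrite -[leRHS]mulr1 ler_wpM2l.
Qed.

Lemma ehrhart_reciprocity_bound : (0 < m)%N -> conv_mx V 0 ->
    (forall y, exists2 c : 'rV_m, (forall j, 0 <= c 0 j) & y = c *m V) ->
  exists p : {poly R}, [/\ (size p <= n.+1)%N,
    forall k, 0 <= p.[k%:R],
    forall k, (0 < k)%N -> exists2 c : nat,
      dilate k (conv_mx V) `&` @integer_lattice R n #= `I_c & p.[k%:R] = c%:R,
    0 <= (-1) ^+ n * p.[- 1]
  & forall k : nat, p.[k.+1%:R] <= (-1) ^+ n * p.[- k.+2%:R]].
Proof.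
move=> m_gt0 V0 Vpos.
have [T [s [T_unit T_sum s_cell s_cell']]] := half_open_fan m_gt0 Vpos.
have [N N_den] := common_denominator.
pose s' f i := ~~ s f i.
have N_neq0 : N.+1%:R != 0 :> R by rewrite pnatr_eq0.
(* The two box points add up to the sum of the rows of the basis, which is integral. *)
have PhiE f r : box_integral s' (f, r) = box_integral s (f, [ffun i => rev_ord (r i : 'I_N.+1)]).
  rewrite /box_integral /=; apply: eq_forallb => j.
  pose w : 'rV[R]_n := \row_i ((r i + s' f i)%N%:R / N.+1%:R).
  rewrite -/w [X in _ = ((X *m _) 0 j \is a Num.int)](_ : _ = const_mx 1 - w); last first.
    apply/rowP => i; rewrite !mxE ffunE.
    have -> : (rev_ord (r i) + s f i = N.+1 - (r i + s' f i))%N.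
      by rewrite /= /s'; have := ltn_ord (r i); case: (s f i) => /=; lia.
    rewrite natrB ?mulrBl ?mulfV //.
    by have := ltn_ord (r i); case: (s' f i) => /=; lia.
  rewrite mulmxBl.
  have -> : (((const_mx 1 : 'rV_n) *m rowsub f V) - w *m rowsub f V) 0 j = 
      ((const_mx 1 : 'rV_n) *m rowsub f V) 0 j - (w *m rowsub f V) 0 j.
    by rewrite mxE [X in _ + X]mxE.
  rewrite rpredBl //; apply: int_mulmx => [i|a b]; rewrite mxE ?V_int //.
have [p [p_size pE pNE]] := @cell_points_reciprocity R F (fun f => f \in T) n N s
  (box_integral s) (box_integral s') PhiE.
set D := cell_points _ _ _ in pE; set D' := dual_cell_points _ _ _ in pNE.
have cell_point_cell k (y : F * {ffun 'I_n -> 'I_N.+1} * n.-tuple 'I_k.+1) :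
    D k y -> T y.1.1 /\ forall i, 0 <= coords V y.1.1 (cell_point s y) 0 i /\
      (s y.1.1 i -> 0 < coords V y.1.1 (cell_point s y) 0 i).
  case/andP => /andP[Ty _] _; split=> // i; rewrite coords_cell_point ?T_unit //.
  split; first by rewrite divr_ge0.
  by move=> si; rewrite divr_gt0 ?ltr0n // si addn1 addnS.
have D_image k : (0 < k)%N ->
    dilate k (conv_mx V) `&` @integer_lattice R n = @cell_point N s k @` [set y | D k y].
  move=> k_gt0; apply/seteqP; split=> [x [kx x_int]|_ [y Dy <-]].
    have [f [[Tf x_cell] _]] := s_cell x.
    have x_sum := dilate_sum_coords (fun j => T_sum f j Tf) kx.
    have [r [t [xE rt]]] := cell_point_surj N_den (T_unit f Tf) x_int x_cell x_sum.
    exists (f, r, t) => //; rewrite /D /= rt; apply/andP; split; first by rewrite andbT.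
    rewrite -(ler_nat R) -[X in X%:R <= _]/(N.+1 * \sum_i tnth (f, r, t).2 i +
      shifted_sum s (f, r, t).1)%N.
    rewrite -sum_coords_cell_point ?T_unit // -xE natrM ler_pM2l ?ltr0n //.
  have [Ty y_cell] := cell_point_cell k y Dy; case/andP: Dy => /andP[_ int_y] y_le.
  split; last by apply/cell_point_int.
  apply: mem_dilate => //.
  rewrite -(mulmxKV (T_unit _ Ty) (cell_point s y)) -/(coords _ _ _) scalemxAl.
  apply: conv_mx_cone => // [i|].
    by rewrite mxE mulr_ge0 ?invr_ge0 //; have [] := y_cell i.
  under eq_bigr do rewrite mxE.
  rewrite -mulr_sumr mulrC ler_pdivrMr ?ltr0n // mul1r.
  rewrite -(ler_pM2l (ltr0n R N.+1)) sum_coords_cell_point ?T_unit //.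
  by rewrite -natrM ler_nat.
(* The unique cell containing the point determines the cone; remainder and quotient by [N.+1] then
   recover [r] and [t]. *)
have D_inj k : {in [set y | D k y] &, injective (@cell_point N s k)}.
  move=> y z /set_mem /= Dy /set_mem /= Dz yz.
  have y_cell := cell_point_cell k y Dy; have z_cell := cell_point_cell k z Dz.
  have [f [_ f_uniq]] := s_cell (cell_point s y).
  have yz1 : y.1.1 = z.1.1.
    by rewrite (f_uniq _ y_cell) (f_uniq z.1.1) // yz.
  have Ty := y_cell.1.
  case: y z yz1 yz Ty {Dy Dz y_cell z_cell f_uniq} => [[g r] t] [[h r'] t'] /= <- yz Tg.
  have rt i : (N.+1 * tnth t i + (r i + s g i) = N.+1 * tnth t' i + (r' i + s g i))%N.
    have := congr1 (fun x => coords V g x 0 i) yz.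
    rewrite (@coords_cell_point N s k (g, r, t) i) ?T_unit //.
    rewrite (@coords_cell_point N s k (g, r', t') i) ?T_unit //= => /(mulIf (invr_neq0 N_neq0)).
    by move/eqP; rewrite eqr_nat => /eqP.
  have {}rt i : (tnth t i * N.+1 + r i = tnth t' i * N.+1 + r' i)%N by have := rt i; lia.
  have -> : r = r'.
    apply/ffunP => i; apply: ord_inj; have := congr1 (modn^~ N.+1) (rt i).
    by rewrite !modnMDl !modn_small.
  congr (_, _); apply: eq_from_tnth => i; apply: ord_inj.
  have := congr1 (divn^~ N.+1) (rt i).
  by rewrite !divnMDl // !divn_small ?addn0.
have D_card k : (0 < k)%N ->
    dilate k (conv_mx V) `&` @integer_lattice R n #= `I_#|D k|.
  move=> k_gt0; rewrite D_image //.
  exact: card_eq_trans (inj_card_eq (D_inj k)) (card_eq_finpred (D k)).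
exists p; split=> //.
- by move=> k; rewrite pE.
- by move=> k k_gt0; exists #|D k|; [exact: D_card | exact: pE].
- by have := pNE 1%N isT; rewrite mulr1n => ->.
move=> k; rewrite pE pNE // ler_nat -card_le_II.
apply: (card_le_trans (B := dilate k.+1 (conv_mx V) `&` @integer_lattice R n)).
  by have := D_card k.+1 isT; rewrite card_eq_le => /andP[].
apply: (card_le_trans (B := @cell_point N s' k.+2 @` [set y | D' k.+2 y])).
  (* The dual cells cover the space, and a gauge of at most [k.+1] satisfies the strict bound
     [k.+2]. *)
  apply: subset_card_le => x [kx x_int].
  have [f [Tf x_cell]] := s_cell' x.
  have x_sum := dilate_sum_coords (fun j => T_sum f j Tf) kx.
  have x_sum' : \sum_i coords V f x 0 i <= k.+2%:R by rewrite (le_trans x_sum) // ler_nat.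
  have [r [t [xE rt]]] := cell_point_surj (s := s') N_den (T_unit f Tf) x_int x_cell x_sum'.
  exists (f, r, t) => //; rewrite /D' /= rt; apply/andP; split; first by rewrite andbT.
  rewrite -(ltr_nat R) -[X in X%:R < _]/(N.+1 * \sum_i tnth (f, r, t).2 i +
    shifted_sum s' (f, r, t).1)%N.
  rewrite -sum_coords_cell_point ?T_unit // -xE natrM ltr_pM2l ?ltr0n //.
  by rewrite (le_lt_trans x_sum) // ltr_nat.
apply: card_le_trans (card_image_le _ _) _.
by have := card_eq_finpred (D' k.+2); rewrite card_eq_le => /andP[].
Qed.

End EhrhartCells.

Theorem proposition1p8 (R : realType) (n : nat) (hn : n \in [:: 1; 2; 3]%N)
    (gamma : R) (hgamma : Gamma0 R n gamma%:C) :
  -1 <= gamma.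
Proof.
case: hgamma => P [lattP symP [G GP rootG]].
have [m [V [PE V_int]]] := lattice_polytope_conv_mx lattP.
have [_ dimP _] := lattP; rewrite {lattP}PE in symP GP dimP.
have [m_gt0 V0 Vpos] := symmetric_conic_span dimP symP.
have [p [p_size p_ge0 p_count pN1 p_dual]] := ehrhart_reciprocity_bound V_int m_gt0 V0 Vpos.
(* The origin is counted, so [p] is nonzero at 1. *)
have p_neq0 : p != 0.
  apply/eqP => p0; have [c card1] := p_count 1%N isT.
  rewrite p0 horner0 => /esym/eqP; rewrite pnatr_eq0 => /eqP c0.
  move: card1; rewrite c0 II0 card_eq0 => /eqP/seteqP[/(_ 0) + _]; apply.
  split; first by exists 0; rewrite ?scaler0.
  by move=> j; rewrite mxE.
have Gp : G = map_poly (real_complex R) p.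
  apply/eqP; rewrite -subr_eq0; apply: contraT => Gp_neq0.
  set q := G - _ in Gp_neq0.
  (* The difference would have the [size q] distinct roots 1, ..., [size q], more than its
     degree. *)
  have := max_poly_roots (rs := [seq (i.+1)%:R | i <- iota 0 (size q)]) Gp_neq0.
  rewrite size_map size_iota ltnn => -> //.
    apply/allP => _ /mapP[i _ ->]; rewrite /root hornerD hornerN subr_eq0.
    have [a cardG ->] := GP i.+1 isT; have [b cardp pb] := p_count i.+1 isT.
    rewrite -(rmorph_nat (real_complex R) i.+1) horner_map /= pb rmorph_nat.
    by apply/eqP; congr (_%:R); apply/card_eq_II; rewrite -(card_eql cardG).
  rewrite map_inj_uniq ?iota_uniq // => i j /eqP.
  by rewrite eqr_nat eqSS => /eqP.
apply: root_ge_N1 hn p_size p_neq0 p_ge0 pN1 p_dual _.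
by move: rootG; rewrite Gp fmorph_root.
Qed.
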